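(* Let $f\in\mathbb{R}[x]_{2d}$ with $f^\star:=\inf_{x\in\mathbb{R}^n}f(x)>-\infty$, and let $\varepsilon>0$ be fixed. For $k\in\mathbb{N}$ let $$\rho_k^1(\varepsilon):=\sup\{\lambda\in\mathbb{R}:\ \theta^k(f-\lambda+\varepsilon\theta^d)\in\Sigma[x]_{k+d}\}.$$ Then: 1. The sequence $(\rho_k^1(\varepsilon))_{k\in\mathbb{N}}$ is monotone non-decreasing. 2. Assume that $f^\star$ is attained at some $x^\star\in\mathbb{R}^n$. Then there exists $K\in\mathbb{N}$ such that $f^\star\le\rho_k^1(\varepsilon)\le f^\star+\varepsilon\,\theta(x^\star)^d$ for all $k\ge K$. In particular, $K$ (which depends on $\varepsilon$) can be chosen so that it is upper bounded by $O(\varepsilon^{-1})$ as $\varepsilon\downarrow0$.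
   Context: $x=(x_1,\dots,x_n)$; $\mathbb{N}$ contains $0$; $\theta(x):=1+\|x\|_2^2$; $\mathbb{R}[x]_t$ is the set of real polynomials of degree at most $t$; $\Sigma[x]_t$ is the set of sums of squares of real polynomials that have degree at most $2t$. The supremum of the empty set is $-\infty$. The constant in $O(\cdot)$ may depend on $f,n,d$ but not on $\varepsilon$. *)

(* Defs.v *)
From HB Require Import structures.
From mathcomp Require Import all_boot all_order all_algebra.
(* mpoly must be imported before analysis: in the other order the notation
   levels of the two libraries conflict. *)
From mathcomp Require Import mpoly.
From mathcomp Require Import boolp classical_sets reals constructive_ereal.
From mathcomp Require Import ereal topology normedtype.

Set Implicit Arguments.
Unset Strict Implicit.
Unset Printing Implicit Defensive.

Import Order.TTheory GRing.Theory Num.Theory.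

Local Open Scope classical_set_scope.
Local Open Scope ring_scope.

Section Definitions.
Context {R : realType} {n : nat}.
Implicit Types (f p q : {mpoly R[n]}) (d k t : nat) (eps lambda : R).

(* msize is 1 + the total degree, and 0 for the zero polynomial. *)
Definition poly_le t : set {mpoly R[n]} := [set p | (msize p <= t.+1)%N].

(* The degree bound 2t is on the sum of squares, not on each square. *)
Definition sos_le t : set {mpoly R[n]} :=
  [set p | (exists s : seq {mpoly R[n]}, p = \sum_(q <- s) q ^+ 2)
           /\ poly_le (2 * t) p].

Definition theta : {mpoly R[n]} := 1 + \sum_(i < n) 'X_i ^+ 2.

Definition fstar f : \bar R :=
  ereal_inf [set (f.@[x])%:E | x in [set: 'I_n -> R]].

(* ereal_sup set0 = -oo. *)
Definition rho f d eps k : \bar R :=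
  ereal_sup [set lambda%:E | lambda in
    [set lambda : R |
      sos_le (k + d) (theta ^+ k * (f - lambda%:MP + eps *: theta ^+ d))]].

End Definitions.

(* Main.v *)
From HB Require Import structures.
Require Import Defs.
From mathcomp Require Import all_boot all_order all_algebra.
From mathcomp Require Import mpoly.
From mathcomp Require Import boolp classical_sets reals constructive_ereal.
From mathcomp Require Import ereal topology normedtype.
From mathcomp Require Import ring lra zify.

Set Implicit Arguments.
Unset Strict Implicit.
Unset Printing Implicit Defensive.

Import Order.TTheory GRing.Theory Num.Theory.

Local Open Scope classical_set_scope.
Local Open Scope ring_scope.

(** Let xs be a minimizer of f and F the degree-2d homogenization of f - f(xs)
    in one more variable, with |X|^2 the sum of all n + 1 squared variables.
    The form F is nonnegative on R^(n+1), and everything rests on finding a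
    constant C, depending on F only, such that |X|^(2k) (F + eps |X|^(2d)) is a
    sum of squares as soon as C < eps (k + 1) (lemma [reznick]).  Setting the
    extra variable to 1 turns |X|^2 into theta, so lambda = f(xs) is feasible for
    all k >= C / eps.  The two other bounds are immediate: a certificate for k
    becomes one for l >= k after multiplication by the sum of squares
    theta^(l-k), and evaluating a certificate at xs shows
    lambda <= f(xs) + eps theta(xs)^d.

    The sum of squares is obtained from the constant-coefficient operator F(D),
    D being the gradient, applied to |X|^(2s) with s = k + 2d.

    - On a power of a linear form l_y = y . X, F(D) gives
      F(D) l_y^(2s) = (2s) (2s - 1) .. (2s - 2d + 1) F(y) l_y^(2s - 2d),
      a square with a nonnegative factor.  By the central limit theorem
      |X|^(2s) is, up to a constant, a limit of rescaled averages of l_y^(2s), y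
      being the position of a simple random walk.  Hence F(D) |X|^(2s) becomes a sum
      of squares after the addition of an arbitrarily small multiple of
      |X|^(2(k + d)) ([sos_diffop_normsqX]).
    - By the Leibniz rule, F(D) |X|^(2s) = c_k |X|^(2k) (F + E_k) with c_k > 0
      and with E_k a form of degree 2d whose coefficients are O(1 / (k + 1))
      ([dominated_diffop_normsqX]).

    Both error terms are swallowed by eps |X|^(2d), because |X|^(2t) dominates,
    modulo sums of squares, every form of degree 2t with small coefficients
    ([dominated_homog]).  The rate O(1 / k) of E_k is what makes K of order
    1 / eps. *)

(** * Sums of squares and domination by powers of the squared norm *)

Section SumsOfSquares.
Context {R : rcfType} {m : nat}.
Implicit Types (p q : {mpoly R[m]}) (t : nat) (a b c : R).

Definition sos p := exists s : seq {mpoly R[m]}, p = \sum_(q <- s) q ^+ 2.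

Lemma sos0 : sos 0.
Proof. by exists [::]; rewrite big_nil. Qed.

Lemma sos_sqr p : sos (p ^+ 2).
Proof. by exists [:: p]; rewrite big_seq1. Qed.

Lemma sosD p q : sos p -> sos q -> sos (p + q).
Proof. by move=> [s ->] [t ->]; exists (s ++ t); rewrite big_cat. Qed.

Lemma sos_sum (I : Type) (r : seq I) (P : pred I) (F : I -> {mpoly R[m]}) :
  (forall i, P i -> sos (F i)) -> sos (\sum_(i <- r | P i) F i).
Proof.
by move=> sF; elim/big_rec: _ => [|i p /sF]; [exact: sos0|exact: sosD].
Qed.

Lemma sosM p q : sos p -> sos q -> sos (p * q).
Proof.
move=> [s ->] [t ->]; rewrite big_distrl; apply: sos_sum => p' _.
by rewrite big_distrr; apply: sos_sum => q' _; rewrite /= -exprMn; apply: sos_sqr.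
Qed.

Lemma sosZ c p : 0 <= c -> sos p -> sos (c *: p).
Proof.
move=> c0 sp; rewrite -mul_mpolyC; apply: sosM => //.
by rewrite -(sqr_sqrtr c0) rmorphXn; apply: sos_sqr.
Qed.

Lemma sos_half p : sos (p + p) -> sos p.
Proof.
move=> /(sosZ (_ : 0 <= 2%:R^-1)); rewrite -mulr2n -[p *+ 2]scaler_nat scalerA.
by rewrite mulVf ?scale1r ?pnatr_eq0 //; apply; rewrite invr_ge0 ler0n.
Qed.

Lemma sosX p t : sos p -> sos (p ^+ t).
Proof.
move=> sp; elim: t => [|t IH]; last by rewrite exprS; apply: sosM.
by rewrite expr0 -(expr1n _ 2); apply: sos_sqr.
Qed.

Lemma sos_meval p (v : 'I_m -> R) : sos p -> 0 <= p.@[v].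
Proof.
move=> [s ->]; rewrite rmorph_sum; apply: sumr_ge0 => q _.
by rewrite rmorphXn sqr_ge0.
Qed.

Definition normsq : {mpoly R[m]} := \sum_(i < m) 'X_i ^+ 2.

Lemma sos_normsqX t : sos (normsq ^+ t).
Proof. by apply/sosX/sos_sum => i _; apply: sos_sqr. Qed.

(** The order-unit relation |p| <= c |X|^(2t) for the order whose positive cone
    is the sums of squares. *)
Definition dominated t c p :=
  sos (c *: normsq ^+ t + p) /\ sos (c *: normsq ^+ t - p).

Lemma dominated0 t : dominated t 0 0.
Proof. by split; rewrite scale0r ?subrr ?addr0; apply: sos0. Qed.

Lemma dominatedD t a b p q :
  dominated t a p -> dominated t b q -> dominated t (a + b) (p + q).
Proof.
move=> [p1 p2] [q1 q2]; split; rewrite scalerDl ?opprD addrACA; exact: sosD.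
Qed.

Lemma dominatedN t c p : dominated t c p -> dominated t c (- p).
Proof. by move=> [p1 p2]; split; rewrite ?opprK. Qed.

Lemma dominatedZ t c a p : dominated t c p -> dominated t (`|a| * c) (a *: p).
Proof.
suff pos b : 0 <= b -> dominated t c p -> dominated t (b * c) (b *: p).
  have [a0|a0] := ger0P a => dp; first exact: pos.
  rewrite -[a in a *: _]opprK scaleNr; apply/dominatedN/pos => //; lra.
move=> b0 [p1 p2].
by split; rewrite -scalerA -?scalerN -scalerDr; apply: sosZ.
Qed.

Lemma dominatedW t a b p : a <= b -> dominated t a p -> dominated t b p.
Proof.
move=> ab [p1 p2]; rewrite /dominated -(subrK a b) scalerDl -!addrA.
by split; apply: sosD => //; apply/sosZ/sos_normsqX; rewrite subr_ge0.
Qed.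

(** In (|X|^(2s) + p) (|X|^(2t) + q) + (|X|^(2s) - p) (|X|^(2t) - q) the cross
    terms cancel, leaving 2 (|X|^(2(s+t)) + p q). *)
Lemma dominatedM s t p q :
  dominated s 1 p -> dominated t 1 q -> dominated (s + t) 1 (p * q).
Proof.
rewrite /dominated !scale1r => -[p1 p2] [q1 q2]; rewrite exprD.
split; apply: sos_half.
- have := sosD (sosM p1 q1) (sosM p2 q2); congr sos; ring.
- have := sosD (sosM p1 q2) (sosM p2 q1); congr sos; ring.
Qed.

Lemma dominated_mul_normsqX k t c p :
  dominated t c p -> dominated (k + t) c (normsq ^+ k * p).
Proof.
move=> [p1 p2]; rewrite /dominated exprD scalerAr -mulrN -!mulrDr.
by split; apply/sosM => //; exact: sos_normsqX.
Qed.

Lemma dominated_sum (I : eqType) (r : seq I) t (c : I -> R)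
    (p : I -> {mpoly R[m]}) :
  (forall i, i \in r -> dominated t (c i) (p i)) ->
  dominated t (\sum_(i <- r) c i) (\sum_(i <- r) p i).
Proof.
move=> dp; rewrite !big_seq.
elim/big_rec2: _ => [|i c' p' /dp]; first exact: dominated0.
exact: dominatedD.
Qed.

(** Twice |X|^2 +/- X_i X_j is (X_i +/- X_j)^2 plus the squares other than X_i^2
    plus those other than X_j^2; this also covers i = j. *)
Lemma dominated_XX (i j : 'I_m) : dominated 1 1 ('X_i * 'X_j).
Proof.
have rest l : exists2 p, sos p & normsq = 'X_l ^+ 2 + p.
  by exists (\sum_(k | k != l) 'X_k ^+ 2);
    [apply: sos_sum => k _; exact: sos_sqr|rewrite /normsq (bigD1 l)].
have [p sp ep] := rest i; have [q sq eq] := rest j.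
have twice w u : w + w = u ^+ 2 + p + q -> sos w.
  move=> uw; apply: sos_half; rewrite uw.
  by apply: sosD => //; apply: sosD => //; exact: sos_sqr.
rewrite /dominated scale1r expr1; split.
- apply: (twice _ ('X_i + 'X_j)); rewrite {1}ep eq; ring.
- apply: (twice _ ('X_i - 'X_j)); rewrite {1}ep eq; ring.
Qed.

End SumsOfSquares.

Lemma mnm_split (m k : nat) (g : 'X_{1..m}) : mdeg g = k.+1 ->
  exists i h, g = (h + U_(i))%MM /\ mdeg h = k.
Proof.
move=> gk; have [i gi] : exists i, (0 < g i)%N.
  apply/existsP; rewrite -[[exists _, _]]negbK negb_exists.
  apply/negP => /forallP g0; suff: g == 0%MM by rewrite -mdeg_eq0 gk.
  by apply/eqP/mnmP => i; rewrite mnm0E; apply/eqP; rewrite -leqn0 leqNgt.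
have le : (U_(i) <= g)%MM by rewrite lep1mP -lt0n.
exists i, (g - U_(i))%MM; rewrite submK //; split=> //.
by apply/eqP; rewrite -(eqn_add2r 1) -{1}(mdeg1 i) -mdegD submK // gk addn1.
Qed.

Section HomogeneousDomination.
Context {R : rcfType} {m : nat}.
Implicit Types (p q : {mpoly R[m]}) (t : nat).

Lemma homog_X (i : 'I_m) : ('X_i : {mpoly R[m]}) \is 1.-homog.
Proof. by rewrite dhomogX; apply/eqP/mdeg1. Qed.

Lemma homog_normsqX t : (normsq : {mpoly R[m]}) ^+ t \is t.*2.-homog.
Proof.
rewrite -mul2n; apply: dhomogMn; apply: rpred_sum => i _.
exact: (dhomogMn 2 (homog_X i)).
Qed.

(** A monomial of even degree is a product of factors X_i X_j. *)
Lemma dominated_mnm t (g : 'X_{1..m}) : mdeg g = t.*2 ->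
  dominated t 1 ('X_[g] : {mpoly R[m]}).
Proof.
elim: t g => [|t IH] g gt.
  have -> : g = 0%MM by apply/eqP; rewrite -mdeg_eq0 gt.
  rewrite mpolyX0 /dominated expr0 scale1r subrr; split; last exact: sos0.
  by rewrite -(expr1n _ 2); apply: sosD; exact: sos_sqr.
have [i [h [-> /mnm_split[j [h' [-> /IH dh]]]]]] := mnm_split gt.
by rewrite -addmA mpolyXD mpolyXD -addn1; apply: dominatedM dh (dominated_XX _ _).
Qed.

Definition coef_norm p := \sum_(g <- msupp p) `|p@_g|.

Lemma coef_norm_ge0 p : 0 <= coef_norm p.
Proof. by apply: sumr_ge0 => g _; apply: normr_ge0. Qed.

Lemma dominated_homog t p : p \is t.*2.-homog -> dominated t (coef_norm p) p.
Proof.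
move=> /dhomogP hp.
rewrite {2}(mpolyE p); apply: dominated_sum => g /hp gt.
by rewrite -[`|_|]mulr1; apply/dominatedZ/dominated_mnm.
Qed.

(** The bound depends on the forms [p i] and on the size of the coefficients
    only: this is what lets error terms with coefficients tending to 0, but
    with fixed forms, be absorbed. *)
Lemma dominated_comb (I : eqType) (r : seq I) t
    (p : I -> {mpoly R[m]}) (a : I -> R) (b : R) :
  (forall i, i \in r -> p i \is t.*2.-homog) ->
  (forall i, i \in r -> `|a i| <= b) ->
  dominated t (b * \sum_(i <- r) coef_norm (p i)) (\sum_(i <- r) a i *: p i).
Proof.
move=> hp ab; rewrite mulr_sumr; apply: dominated_sum => i ir.
apply: (dominatedW (a := `|a i| * coef_norm (p i))).
  by apply: ler_wpM2r; [exact: coef_norm_ge0|exact: ab].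
exact/dominatedZ/dominated_homog/hp.
Qed.

End HomogeneousDomination.

(** * Constant-coefficient differential operators *)

Section Derivatives.
Context {R : rcfType} {m : nat}.
Implicit Types (p q F : {mpoly R[m]}) (y : 'I_m -> R) (g : 'X_{1..m}).

Definition linform y : {mpoly R[m]} := \sum_(i < m) y i *: 'X_i.

Lemma linformD y z : linform (fun i => y i + z i) = linform y + linform z.
Proof. by rewrite -big_split; apply: eq_bigr => i _; rewrite scalerDl. Qed.

Lemma mderiv_exp p e i : (p ^+ e)^`M(i) = e%:R *: (p ^+ e.-1 * p^`M(i)).
Proof.
elim: e => [|e IH]; first by rewrite expr0 mderivC scale0r.
rewrite exprS mderivM IH -!mul_mpolyC; case: e {IH} => [|e].
  by rewrite !expr0 mpolyC0 mpolyC1; ring.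
by rewrite !rmorph_nat /= exprS; ring.
Qed.

Lemma mderiv_var (i j : 'I_m) : ('X_j : {mpoly R[m]})^`M(i) = (i == j)%:R.
Proof.
rewrite mderivX mnmE eq_sym; case: eqVneq => [->|_]; last by rewrite scale0r.
by rewrite scale1r -{1}[U_(j)%MM]addm0 addmC addmK mpolyX0.
Qed.

Lemma mderiv_linform y i : (linform y)^`M(i) = (y i)%:MP.
Proof.
rewrite raddf_sum (bigD1 i) //= linearZ /= mderiv_var eqxx big1 => [|j ji].
  by rewrite addr0 -mul_mpolyC mulr1.
by rewrite linearZ /= mderiv_var eq_sym (negPf ji) scaler0.
Qed.

Lemma mderiv_normsq i : (@normsq R m)^`M(i) = 2%:R *: 'X_i.
Proof.
rewrite raddf_sum (bigD1 i) //= mderiv_exp mderiv_var eqxx mulr1 big1 ?addr0 //.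
by move=> j ji; rewrite mderiv_exp mderiv_var eq_sym (negPf ji) mulr0 scaler0.
Qed.

Lemma mderivm_linform y e g : (linform y ^+ e)^`M[g] =
  ((e ^_ (mdeg g))%:R * 'X_[g].@[y]) *: linform y ^+ (e - mdeg g).
Proof.
move: {2}(mdeg g) (erefl (mdeg g)) => k; elim: k g => [|k IH] g gk.
  move/eqP: gk; rewrite mdeg_eq0 => /eqP->; rewrite ?mdeg0.
  by rewrite mderivm0m mpolyX0 meval1 mulr1 subn0 scale1r.
rewrite gk; have [i [h [-> hk]]] := mnm_split gk.
rewrite mderivmDm IH // hk mderivmU1m linearZ /= mderiv_exp mderiv_linform.
rewrite ffactnSr mpolyXD mevalM mevalXU -subnS natrM.
rewrite -!mul_mpolyC !rmorphM /=; ring.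
Qed.

Lemma homog_mderiv p e i : p \is e.-homog -> p^`M(i) \is e.-1.-homog.
Proof.
move=> /dhomogP hp; apply/dhomogP => g; rewrite mcoeff_msupp mcoeff_deriv.
move=> nz; have/hp <- : (g + U_(i))%MM \in msupp p.
  by rewrite mcoeff_msupp; apply: contra nz => /eqP->; rewrite mul0rn.
by rewrite /= mdegD mdeg1 addn1.
Qed.

Lemma homog_mderivm p e g : p \is e.-homog -> p^`M[g] \is (e - mdeg g).-homog.
Proof.
move=> hp; move: {2}(mdeg g) (erefl (mdeg g)) => k; elim: k g => [|k IH] g gk.
  by move/eqP: gk; rewrite mdeg_eq0 => /eqP->; rewrite mderivm0m mdeg0 subn0.
rewrite gk; have [i [h [-> hk]]] := mnm_split gk.
by rewrite mderivmDm mderivmU1m subnS -hk; apply/homog_mderiv/IH.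
Qed.

(** This is F(D), the variables of F being replaced by partial derivatives. *)
Definition diffop F p := \sum_(g <- msupp F) F@_g *: p^`M[g].

Lemma diffop_is_linear F : linear (diffop F).
Proof.
move=> c p q; rewrite /diffop scaler_sumr -big_split; apply: eq_bigr => g _.
by rewrite linearP scalerDr !scalerA mulrC.
Qed.
HB.instance Definition _ F :=
  GRing.isLinear.Build R {mpoly R[m]} {mpoly R[m]} _ (diffop F) (diffop_is_linear F).

Lemma homog_diffop F p d e : F \is d.-homog -> p \is e.-homog ->
  diffop F p \is (e - d).-homog.
Proof.
move=> /dhomogP hF hp; rewrite /diffop big_seq; apply: rpred_sum => g /hF <-.
exact/dhomogZ/homog_mderivm.
Qed.

(** Each partial derivative of a power of y . X produces a factor y_i, so F(D)
    evaluates F at y; homogeneity of F makes the falling factorial the same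
    for all its monomials. *)
Lemma diffop_linform F d y e : F \is d.-homog ->
  diffop F (linform y ^+ e) = ((e ^_ d)%:R * F.@[y]) *: linform y ^+ (e - d).
Proof.
move=> /dhomogP hF; rewrite {2}(mpolyE F) raddf_sum mulr_sumr scaler_suml.
rewrite /diffop big_seq [RHS]big_seq; apply: eq_bigr => g /hF gd.
by rewrite mderivm_linform gd /= mevalZ scalerA mulrCA.
Qed.

End Derivatives.

(** * Moments of the simple random walk *)

Section Moments.
Context {R : rcfType} {n : nat}.
Local Notation m := n.+1.
Local Notation poly := {mpoly R[m]}.
Implicit Types (y : 'I_m -> R) (p q : poly) (M : nat -> poly).

(** [M a] is the a-th moment of y . X for y drawn from a finitely supported
    positive measure, given as a list of weights and points. *)
Definition moments M := exists2 L : seq (R * ('I_m -> R)),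
  (forall u, List.In u L -> 0 <= u.1) &
  forall a, M a = \sum_(u <- L) u.1 *: linform u.2 ^+ a.

(** The moments of the sum of two independent random vectors, by the binomial
    theorem. *)
Definition convolution M M' a := \sum_(i < a.+1) M (a - i)%N * M' i *+ 'C(a, i).

Lemma moments_convolution M M' :
  moments M -> moments M' -> moments (convolution M M').
Proof.
move=> [L L0 eM] [L' L'0 eM'].
exists [seq (u.1 * v.1, fun i => u.2 i + v.2 i) | u <- L, v <- L'].
  elim: L L0 {eM} => [|u L IH] L0 w //=; rewrite List.in_app_iff => -[].
  - elim: L' L'0 {eM' IH} => [|v L' IH] L'0 //= [<-|wL'].
      by apply: mulr_ge0; [apply: L0; left|apply: L'0; left].
    by apply: IH => // v' v'L'; apply: L'0; right.
  - by apply: IH => u' u'L; apply: L0; right.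
move=> a; rewrite big_allpairs_dep /convolution /=.
under eq_bigr => i _.
  rewrite eM eM' big_distrlr /= -sumrMnl.
  under eq_bigr => u _ do rewrite -sumrMnl.
  over.
rewrite exchange_big; apply: eq_bigr => u _ /=.
rewrite exchange_big; apply: eq_bigr => v _ /=.
rewrite linformD exprDn scaler_sumr; apply: eq_bigr => i _.
by rewrite -scalerMnr -!(scalerAl, scalerAr) scalerA.
Qed.

(** Moments of the uniform distribution on the vectors +/- e_i. *)
Definition step a : poly :=
  \sum_(i < m) (2 * m)%:R^-1 *: ('X_i ^+ a + (- 'X_i) ^+ a).

Lemma moments_step : moments step.
Proof.
pose e (c : R) i : 'I_m -> R := fun j => c * (j == i)%:R.
have linE c i : linform (e c i) = c *: 'X_i.
  rewrite /linform (bigD1 i) //= /e eqxx mulr1 big1 ?addr0 // => j /negPf ->.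
  by rewrite mulr0 scale0r.
pose w : R := (2 * m)%:R^-1.
exists ([seq (w, e 1 i) | i <- enum 'I_m] ++ [seq (w, e (-1) i) | i <- enum 'I_m]).
  move=> u; rewrite List.in_app_iff !List.in_map_iff.
  by move=> [] [i [<- _]] /=; rewrite invr_ge0 ler0n.
move=> a; rewrite big_cat !big_map -!enumT /= !big_enum /= -big_split.
by apply: eq_bigr => i _; rewrite !linE scale1r scaleN1r scalerDr.
Qed.

Fixpoint walk N : nat -> poly :=
  if N is N'.+1 then convolution (walk N') step else fun a => (a == 0%N)%:R.

Lemma moments_walk N : moments (walk N).
Proof.
elim: N => [|N IH]; last exact: moments_convolution moments_step.
exists [:: (1, fun=> 0)] => [u [<-|[]]|a]; first exact: ler01.
rewrite big_seq1 scale1r /linform big1 ?expr0n // => i _; exact: scale0r.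
Qed.

Lemma step0 : step 0 = 1.
Proof.
rewrite /step; under eq_bigr do rewrite !expr0 -mulr2n -scaler_nat scalerA.
rewrite sumr_const card_ord scalerMnl -mulr_natr -mulrA -natrM.
by rewrite mulVf ?scale1r // pnatr_eq0.
Qed.

Lemma step1 : step 1 = 0.
Proof. by rewrite /step big1 // => i _; rewrite subrr scaler0. Qed.

Lemma step2 : step 2 = m%:R^-1 *: normsq.
Proof.
rewrite /step -scaler_sumr /normsq.
under eq_bigr => i _ do rewrite sqrrN -mulr2n -scaler_nat.
by rewrite -scaler_sumr scalerA natrM invfM mulrAC mulVf ?mul1r // pnatr_eq0.
Qed.

Lemma homog_step e : step e \is e.-homog.
Proof.
apply: rpred_sum => i _; apply/dhomogZ/rpredD.
  by have := dhomogMn e (@homog_X R _ i); rewrite mul1n.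
have hN : (- 'X_i : poly) \is 1.-homog by rewrite rpredN; exact: homog_X.
by have := dhomogMn e hN; rewrite mul1n.
Qed.

(** The moments of the walk are polynomial in the number N of steps.  Written
    in the binomial basis 'C(N, j), their coefficients obey this recursion:
    one more step changes the a-th moment by the sum over i > 0 of
    'C(a, i) step_i times the (a - i)-th moment, and passing from N to N + 1
    shifts the binomial basis by one index. *)
Fixpoint walk_coef j a : poly :=
  if j is j'.+1 then
    \sum_(i < a) walk_coef j' (a - i.+1)%N * step i.+1 *+ 'C(a, i.+1)
  else (a == 0%N)%:R.

Lemma homog_walk_coef j e : walk_coef j e \is e.-homog.
Proof.
elim: j e => [|j IH] e /=.
  by case: eqVneq => [->|_]; [exact: (@dhomog1 _ _ mdeg)|exact: rpred0].
apply: rpred_sum => i _; apply: rpredMn.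
by have := dhomogM (IH (e - i.+1)%N) (homog_step i.+1); rewrite subnK.
Qed.

(** As [step 1 = 0], each step uses up at least two units of degree. *)
Lemma walk_coef_eq0 j a : (a < j.*2)%N -> walk_coef j a = 0.
Proof.
elim: j a => [|j IH] a //=; rewrite doubleS => lt_a.
apply: big1 => -[[|i] /= lti] _; first by rewrite step1 mulr0 mul0rn.
rewrite IH ?mul0r ?mul0rn // ltn_subLR // (leq_trans lt_a) //.
by rewrite !addSn !ltnS leq_addl.
Qed.

(** The leading coefficient in N of the 2s-th moment only involves the second
    moments of the steps; it is, up to a factor, the Gaussian moment
    |X|^(2s). *)
Lemma walk_coef_top s : exists2 c : R, 0 < c & walk_coef s s.*2 = c *: normsq ^+ s.
Proof.
elim: s => [|s [c c0 IH]]; first by exists 1; rewrite ?scale1r.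
exists ('C(s.*2.+2, 2)%:R * c / m%:R).
  by rewrite !mulr_gt0 ?invr_gt0 ?ltr0n ?bin_gt0.
rewrite doubleS /= !big_ord_recl /= big1 => [|i _]; last first.
  rewrite /bump /= !add1n walk_coef_eq0 ?mul0r ?mul0rn //.
  by rewrite !subSS ltn_subrL (leq_trans _ (ltn_ord i)).
rewrite step1 mulr0 mul0rn add0r addr0 /bump /= !subSS subn0 IH step2.
rewrite -!(scalerAl, scalerAr) scalerA -exprSr.
by rewrite -scaler_nat scalerA mulrA.
Qed.

Lemma walkE N a J : (a < J.+1.*2)%N ->
  walk N a = \sum_(j < J.+1) walk_coef j a *+ 'C(N, j).
Proof.
elim: N a => [|N IH] a aJ.
  rewrite big_ord_recl /= mulr1n big1 ?addr0 // => i _; exact: mulr0n.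
rewrite /= /convolution big_ord_recl /= subn0 step0 mulr1 bin0 mulr1n.
rewrite (IH a aJ) big_ord_recl [in RHS]big_ord_recl !bin0 -!addrA; congr (_ + _).
under [in RHS]eq_bigr => j _ do rewrite binS mulrnDr.
rewrite big_split /=; congr (_ + _).
transitivity (\sum_(j < J.+1) walk_coef j.+1 a *+ 'C(N, j)); last first.
  by rewrite big_ord_recr /= -/(walk_coef J.+1 a) walk_coef_eq0 // mul0rn addr0.
under eq_bigr => i _.
  rewrite /bump /= add1n IH; last by apply: leq_ltn_trans aJ; exact: leq_subr.
  rewrite mulr_suml -sumrMnl; over.
rewrite exchange_big; apply: eq_bigr => j _; rewrite /= -sumrMnl.
by apply: eq_bigr => i _; rewrite mulrnAl mulrnAC.
Qed.

End Moments.

(** * Derivatives of powers of the squared norm *)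

Section NormsqDerivatives.
Context {R : rcfType} {m : nat}.
Local Notation poly := {mpoly R[m]}.
Implicit Types (p q F : poly) (g : 'X_{1..m}).
Local Notation normsq := (@normsq R m).

(** p is a form of degree D - 2j; truncated subtraction would give a wrong
    meaning when D < 2j, where p has to vanish. *)
Definition codegree D j p := p = 0 \/ exists2 e, (e + j.*2 = D)%N & p \is e.-homog.

Lemma codegreeD D j p q : codegree D j p -> codegree D j q -> codegree D j (p + q).
Proof.
move=> [->|[e eD hp]] [->|[e' e'D hq]]; rewrite ?addr0 ?add0r.
- by left.
- by right; exists e'.
- by right; exists e.
- right; exists e => //; apply: rpredD => //; suff -> : e = e' by [].
  by apply/eqP; rewrite -(eqn_add2r j.*2) eD e'D.
Qed.

Lemma codegreeX D j p i : codegree D j p -> codegree D.+1 j ('X_i * p).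
Proof.
move=> [->|[e eD hp]]; first by left; rewrite mulr0.
right; exists e.+1; first by rewrite addSn eD.
exact: dhomogM (homog_X i) hp.
Qed.

Lemma codegree_mderiv D j p i : codegree D j p -> codegree D.+1 j.+1 (p^`M(i)).
Proof.
move=> [->|[e eD hp]]; first by left; rewrite mderiv0.
case: e eD hp => [|e] eD hp; last move/homog_mderiv: hp => hp.
  left; apply/mpolyP => g; rewrite mcoeff_deriv mcoeff0.
  by rewrite (dhomog_nemf_coeff hp) ?mul0rn //= mdegD mdeg1 addn1.
right; exists e; last exact: hp.
by rewrite doubleS -eD !addSn !addnS.
Qed.

(** In closed form H j is Delta^j X^g / (2^j j!), Delta being the Laplacian.
    Only H 0 and the degrees matter, so the recursion
    H_(g + e_i) j = X_i H_g j + d_i H_g (j - 1), read off from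
    d_i |X|^(2b) = 2 b X_i |X|^(2(b - 1)), is enough.  The forms H j do not
    depend on the exponent s. *)
Lemma mderivm_normsqX g : exists H : nat -> poly,
  [/\ H 0%N = 'X_[g], forall j, codegree (mdeg g) j (H j) &
    forall s, (mdeg g <= s)%N -> (normsq ^+ s)^`M[g] =
      \sum_(j < (mdeg g).+1) (2 ^ (mdeg g - j) * s ^_ (mdeg g - j))%:R *:
        (normsq ^+ (s - mdeg g + j) * H j)].
Proof.
move: {2}(mdeg g) (erefl (mdeg g)) => D; elim: D g => [|D IH] g gD.
  move/eqP: gD; rewrite mdeg_eq0 => /eqP->; rewrite mdeg0.
  exists (fun j => (j == 0%N)%:R); split => [|j|s _].
  - by rewrite mpolyX0.
  - case: j => [|j]; last by left.
    by right; exists 0%N => //; exact: (@dhomog1 _ _ mdeg).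
  - by rewrite big_ord1 mderivm0m subn0 mulr1 scale1r addn0.
rewrite gD; have [i [h [-> hD]]] := mnm_split gD.
have [H [H0 Hdeg Hs]] := IH h hD.
pose dH j := if j is j'.+1 then (H j')^`M(i) else 0.
exists (fun j => 'X_i * H j + dH j); split => [|j|s Ds].
- by rewrite H0 addr0 mpolyXD mulrC.
- apply: codegreeD; first by rewrite -hD; apply: codegreeX.
  by case: j => [|j]; [left|rewrite -hD; apply: codegree_mderiv].
(* Both sums over H get D + 1 terms; the extra term j = D + 1 vanishes. *)
have HD : H D.+1 = 0.
  by case: (Hdeg D.+1) => // -[e]; rewrite hD; lia.
rewrite mderivmDm mderivmU1m Hs ?hD; last exact: ltnW.
under [RHS]eq_bigr => j _ do rewrite mulrDr scalerDr.
rewrite [RHS]big_split /= [X in X + _]big_ord_recr /= HD !mulr0 scaler0 addr0.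
rewrite [X in _ + X]big_ord_recl /= mulr0 scaler0 add0r -big_split raddf_sum.
apply: eq_bigr => -[j /= jD] _.
rewrite linearZ /= mderivM mderiv_exp mderiv_normsq scalerDr.
congr (_ + _); last first.
  rewrite /bump /= add1n subSS; congr (_ *: (normsq ^+ _ * _)); lia.
have {}jD : (j <= D)%N by [].
rewrite (subSn jD) ffactnSr.
have -> : (s - (D - j) = s - D + j)%N by lia.
have -> : (s - D.+1 + j = (s - D + j).-1)%N by lia.
rewrite expnS !natrM -!mul_mpolyC !rmorphM /= !rmorph_nat; ring.
Qed.

(** For j > 0 the coefficient of index j in [mderivm_normsqX] is smaller than
    the leading one by a factor of at least k + 1, the last factor of
    (k + D) (k + D - 1) .. (k + 1). *)
Lemma ffact_ratio D k j : (0 < j <= D)%N ->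
  (2 ^ (D - j) * (k + D) ^_ (D - j) * k.+1 <= 2 ^ D * (k + D) ^_ D)%N.
Proof.
move=> /andP[j0 jD]; rewrite -mulnA; apply: leq_mul.
  by rewrite leq_exp2l // leq_subr.
case: D jD => [|D] jD; first by move: j0 jD; lia.
rewrite [X in (_ <= X)%N]ffactnSr.
apply: leq_mul; last by lia.
have le a : (a <= D)%N -> ((k + D.+1) ^_ (D - a) <= (k + D.+1) ^_ D)%N.
  elim: a => [|a IHa] aD; first by rewrite subn0.
  apply: leq_trans (IHa (ltnW aD)).
  rewrite -(subnSK aD) ffactnSr; apply: leq_pmulr; lia.
by have -> : (D.+1 - j = D - j.-1)%N; [lia|apply: le; lia].
Qed.

(** The coefficient of |X|^(2k) X^g in the g-th derivative of |X|^(2(k + D)),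
    g being of degree D. *)
Definition normsq_scale k D : R := (2 ^ D * (k + D) ^_ D)%:R.

Lemma normsq_scale_gt0 k D : 0 < normsq_scale k D.
Proof. by rewrite ltr0n muln_gt0 expn_gt0 ffact_gt0 leq_addl. Qed.

Lemma dominated_mderivm_normsqX d g : mdeg g = d.*2 -> exists2 C : R, 0 <= C &
  forall k, dominated (k + d) (k.+1%:R^-1 * C)
    (normsq ^+ k * 'X_[g] -
     (normsq_scale k d.*2)^-1 *: (normsq ^+ (k + d.*2))^`M[g]).
Proof.
move=> gd; have [H [H0 Hdeg Hs]] := mderivm_normsqX g.
pose p (j : 'I_d.*2) := normsq ^+ j.+1 * H j.+1.
exists (\sum_(j <- enum 'I_d.*2) coef_norm (p j)).
  by apply: sumr_ge0 => j _; apply: coef_norm_ge0.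
move=> k; have c0 := normsq_scale_gt0 k d.*2.
pose a (j : 'I_d.*2) := - ((normsq_scale k d.*2)^-1 *
  (2 ^ (d.*2 - j.+1) * (k + d.*2) ^_ (d.*2 - j.+1))%:R).
have -> : normsq ^+ k * 'X_[g] -
      (normsq_scale k d.*2)^-1 *: (normsq ^+ (k + d.*2))^`M[g] =
    normsq ^+ k * \sum_(j <- enum 'I_d.*2) a j *: p j.
  rewrite Hs gd ?leq_addl // big_ord_recl /= !subn0 addn0 addnK H0.
  rewrite scalerDr scalerA mulVf ?gt_eqF // scale1r opprD addrA subrr add0r.
  rewrite big_enum /= mulr_sumr scaler_sumr -sumrN; apply: eq_bigr => j _.
  rewrite /bump /= add1n scalerA -scaleNr exprD -mulrA scalerAr.
  by rewrite [normsq ^+ k * _]mulrC -!scalerAl mulrC.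
apply/dominated_mul_normsqX/dominated_comb => j _.
- rewrite /p; case: (Hdeg j.+1) => [->|[e eD hH]].
    by rewrite mulr0; exact: rpred0.
  by have := dhomogM (homog_normsqX j.+1) hH; rewrite addnC eD gd.
- rewrite normrN normrM gtr0_norm ?invr_gt0 // normr_nat mulrC ler_pdivrMr //.
  rewrite mulrC ler_pdivlMr ?ltr0n // -natrM ler_nat.
  by apply: ffact_ratio; rewrite /= ltn_ord.
Qed.

(** F(D) |X|^(2(k + 2d)) is, after rescaling, |X|^(2k) F up to an error of
    relative size O(1 / (k + 1)). *)
Lemma dominated_diffop_normsqX d F : F \is d.*2.-homog -> exists2 C : R, 0 <= C &
  forall k, dominated (k + d) (k.+1%:R^-1 * C)
    (normsq ^+ k * F -
     (normsq_scale k d.*2)^-1 *: diffop F (normsq ^+ (k + d.*2))).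
Proof.
move=> /dhomogP hF; rewrite /diffop {1}(mpolyE F).
elim: (msupp F) hF => [|g r IH] hr.
  exists 0 => // k; rewrite !big_nil !mulr0 scaler0 subrr; exact: dominated0.
have [h hr'|C C0 dC] := IH; first by apply: hr; rewrite inE hr' orbT.
have gd : mdeg g = d.*2 by apply: hr; rewrite inE eqxx.
have [C' C'0 dC'] := dominated_mderivm_normsqX gd.
exists (`|F@_g| * C' + C) => [|k]; first by rewrite addr_ge0 // mulr_ge0.
rewrite !big_cons !mulrDr scalerDr opprD addrACA.
apply: dominatedD (dC k).
rewrite mulrCA -scalerAr scalerA [_^-1 * _]mulrC -scalerA -scalerBr.
exact/dominatedZ/dC'.
Qed.

End NormsqDerivatives.

(** * Positive forms times powers of the squared norm *)

(** 'C(N, j) / 'C(N, s) tends to 0 as N grows when j < s: the top term dominates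
    in the moments of a long walk.  The number N is chosen so that each of the
    ratios 'C(N, j + 1) / 'C(N, j) = (N - j) / (j + 1) is at least B. *)
Lemma bin_ratio s B : (0 < B)%N -> let N := (s + s * B)%N in
  forall j, (j < s)%N -> ('C(N, j) * B <= 'C(N, s))%N.
Proof.
move=> B0 N.
have step j : (j < s)%N -> ('C(N, j) * B <= 'C(N, j.+1))%N.
  move=> js; have jB : (j.+1 * B <= N - j)%N.
    apply: leq_trans (_ : s * B <= _)%N; first by rewrite leq_mul2r js orbT.
    rewrite /N; lia.
  rewrite -(@leq_pmul2l j.+1) // mul_bin_left mulnA mulnAC.
  by rewrite leq_mul2r jB orbT.
have mono t : (t <= s)%N -> forall j, (j <= t)%N -> ('C(N, j) <= 'C(N, t))%N.
  elim: t => [|t IH] ts j; first by rewrite leqn0 => /eqP->.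
  rewrite leq_eqVlt => /orP[/eqP->//|jt].
  apply: leq_trans (IH (ltnW ts) j jt) _.
  by apply: leq_trans (step t ts); exact: leq_pmulr.
by move=> j js; apply: leq_trans (step j js) (mono s _ _ _).
Qed.

Section Reznick.
Context {R : archiRcfType} {n : nat}.
Local Notation m := n.+1.
Local Notation poly := {mpoly R[m]}.
Implicit Types (p F : poly) (M : nat -> poly).
Local Notation normsq := (@normsq R m).

Lemma sos_diffop_moments F d M k : F \is d.*2.-homog ->
  (forall y, 0 <= F.@[y]) -> moments M ->
  sos (diffop F (M (k + d.*2).*2)).
Proof.
move=> hF F0 [L L0 ->]; rewrite raddf_sum /=.
elim: L L0 => [|u L IH] L0; first by rewrite big_nil; exact: sos0.
rewrite big_cons; apply: sosD; last by apply: IH => v vL; apply: L0; right.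
rewrite linearZ /= (diffop_linform _ _ hF) scalerA.
have -> : ((k + d.*2).*2 - d.*2 = (k + d) * 2)%N by lia.
rewrite exprM; apply: sosZ; last exact: sos_sqr.
by rewrite mulr_ge0 ?mulr_ge0 // L0 //; left.
Qed.

(** The 2s-th moment of a walk of N steps is c 'C(N, s) |X|^(2s) plus terms
    with binomials of lower index.  Apply F(D) and divide by 'C(N, s): the
    moment becomes a sum of squares, and for N large the lower terms are
    dominated by an arbitrarily small multiple of |X|^(2(k + d)). *)
Lemma sos_diffop_normsqX F d k eta : F \is d.*2.-homog ->
  (forall y, 0 <= F.@[y]) -> 0 < eta ->
  sos (diffop F (normsq ^+ (k + d.*2)) + eta *: normsq ^+ (k + d)).
Proof.
move=> hF F0 eta0; set s := (k + d.*2)%N.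
have [c c0 cE] := @walk_coef_top R n s.
pose p (j : 'I_s) := diffop F (walk_coef j s.*2).
pose C := \sum_(j <- enum 'I_s) coef_norm (p j).
have C0 : 0 <= C by apply: sumr_ge0 => j _; exact: coef_norm_ge0.
pose B := (Num.bound (C / (c * eta))).+1.
have CB : B%:R^-1 * C <= c * eta.
  rewrite mulrC ler_pdivrMr ?ltr0n // mulrC -ler_pdivrMr ?mulr_gt0 //.
  apply: le_trans (ltW (archi_boundP _)) _.
    by rewrite divr_ge0 // mulr_ge0 // ltW.
  by rewrite ler_nat.
pose N := (s + s * B)%N.
have b0 : 0 < 'C(N, s)%:R :> R by rewrite ltr0n bin_gt0 leq_addr.
pose a (j : 'I_s) : R := - ('C(N, j)%:R / 'C(N, s)%:R).
have dp : dominated (k + d) (B%:R^-1 * C) (\sum_(j <- enum 'I_s) a j *: p j).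
  apply: dominated_comb => j _.
    have := homog_diffop hF (homog_walk_coef (R := R) (n := n) j s.*2).
    by have -> : (s.*2 - d.*2 = (k + d).*2)%N by rewrite /s; lia.
  rewrite normrN ger0_norm ?divr_ge0 // ler_pdivrMr //.
  by rewrite mulrC ler_pdivlMr ?ltr0n // -natrM ler_nat; apply: bin_ratio.
have E : c *: diffop F (normsq ^+ s) = 'C(N, s)%:R^-1 *: diffop F (walk N s.*2)
    + \sum_(j <- enum 'I_s) a j *: p j.
  rewrite (@walkE _ _ N s.*2 s) ?ltn_double // big_ord_recr /= cE.
  rewrite raddfD /= raddfMn /= linearZ /= -[(c *: _) *+ _]scaler_nat scalerDr.
  rewrite !scalerA ?mulrA.
  rewrite mulVf ?gt_eqF // mul1r addrAC (raddf_sum (diffop F)) /=.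
  rewrite [_ *: \sum_(_ < _) _]scaler_sumr big_enum /=.
  rewrite -big_split big1 ?add0r // => j _ /=.
  rewrite raddfMn /= -scaler_nat scalerA -/(p j) -scalerDl /a.
  by rewrite mulrC subrr scale0r.
suff : sos (c *: (diffop F (normsq ^+ s) + eta *: normsq ^+ (k + d))).
  move=> /(sosZ (_ : 0 <= c^-1)); rewrite scalerA mulVf ?gt_eqF // scale1r.
  by apply; rewrite invr_ge0 ltW.
rewrite scalerDr E -addrA scalerA; apply: sosD.
  apply: sosZ; first by rewrite invr_ge0 ltW.
  by apply: sos_diffop_moments => //; exact: moments_walk.
by rewrite addrC; have [] := dominatedW CB dp.
Qed.

(** Reznick's theorem on uniform denominators, with the size of the exponent:
    |X|^(2k) (F + eps |X|^(2d)) is the sum of the rescaled F(D) |X|^(2(k + 2d))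
    and of the defect bounded in [dominated_diffop_normsqX], each completed to a
    sum of squares by a part of eps |X|^(2(k + d)). *)
Lemma reznick F d : F \is d.*2.-homog -> (forall y, 0 <= F.@[y]) ->
  exists2 C : R, 0 <= C & forall k eps, C < eps * k.+1%:R ->
    sos (normsq ^+ k * (F + eps *: normsq ^+ d)).
Proof.
move=> hF F0; have [C C0 dC] := dominated_diffop_normsqX hF; exists C => // k eps Ck.
have c0 : 0 < normsq_scale k d.*2 :> R by exact: normsq_scale_gt0.
(* The choice of eta spends all of eps that the defect C / (k + 1) leaves. *)
pose eta : R := normsq_scale k d.*2 * (eps - k.+1%:R^-1 * C).
have eta0 : 0 < eta.
  by rewrite mulr_gt0 // subr_gt0 mulrC ltr_pdivrMr ?ltr0n.
have sP := sos_diffop_normsqX k hF F0 eta0; have [sQ _] := dC k.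
have c0' : 0 <= (normsq_scale k d.*2)^-1 :> R by rewrite invr_ge0 ltW.
have := sosD sQ (sosZ c0' sP); congr sos.
rewrite scalerDr scalerA /eta mulKf ?gt_eqF // scalerBl mulrDr -scalerAr -exprD.
by rewrite -!mul_mpolyC; ring.
Qed.

End Reznick.

(** * Homogenization *)

(** If p(0) < 0, then p - p(0)/2 changes sign on [0, 1], hence p takes the
    negative value p(0)/2 at a point other than 0. *)
Lemma poly_ge0_punctured (R : rcfType) (p : {poly R}) :
  (forall t, t != 0 -> 0 <= p.[t]) -> 0 <= p.[0].
Proof.
move=> p0; rewrite leNgt; apply/negP => p0lt.
have [||t t01] := @poly_ivt R (p - (p.[0] / 2)%:P) 0 1; first exact: ler01.
  by rewrite !hornerD !hornerN !hornerC; have := p0 1 (oner_neq0 R); lra.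
rewrite rootE hornerD hornerN hornerC subr_eq0 => /eqP pt.
have [t0|/p0] := eqVneq t 0; last by rewrite pt; lra.
by move: pt; rewrite t0; lra.
Qed.

Section Homogenization.
Context {R : rcfType} {n : nat}.
Implicit Types (f p q : {mpoly R[n]}) (g : 'X_{1..n}).

Definition homogenize_mnm D g : 'X_{1..n.+1} :=
  (U_(ord0) *+ (D - mdeg g) + \sum_(i < n) U_(lift ord0 i) *+ g i)%MM.

Definition homogenize D f : {mpoly R[n.+1]} :=
  \sum_(g <- msupp f) f@_g *: 'X_[homogenize_mnm D g].

Lemma mpolyX_homogenize_mnm D g : 'X_[homogenize_mnm D g] =
  'X_ord0 ^+ (D - mdeg g) * \prod_(i < n) 'X_(lift ord0 i) ^+ g i :> {mpoly R[n.+1]}.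
Proof.
rewrite mpolyXD -mpolyXn; congr (_ * _).
rewrite (big_morph _ (@mpolyXD n.+1 R) (@mpolyX0 n.+1 R)).
by apply: eq_bigr => i _; rewrite -mpolyXn.
Qed.

Lemma homog_homogenize D f : (msize f <= D.+1)%N -> homogenize D f \is D.-homog.
Proof.
move=> fD; rewrite /homogenize big_seq; apply: rpred_sum => g gf; apply: dhomogZ.
rewrite dhomogX; apply/eqP; rewrite /= mdegD mdegMn mdeg1 mul1n mdeg_sum.
under eq_bigr => i _ do rewrite mdegMn mdeg1 mul1n.
rewrite -mdegE subnK // -ltnS; exact: leq_trans (msize_mdeg_lt gf) fD.
Qed.

Definition dehomogenize : {mpoly R[n.+1]} -> {mpoly R[n]} :=
  mmap (@mpolyC n R) (fun j => if unlift ord0 j is Some i then 'X_i else 1).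
HB.instance Definition _ := GRing.RMorphism.on dehomogenize.

Lemma dehomogenizeZ c (p : {mpoly R[n.+1]}) :
  dehomogenize (c *: p) = c *: dehomogenize p.
Proof. by rewrite /dehomogenize mmapZ mul_mpolyC. Qed.

Lemma dehomogenize_X0 : dehomogenize 'X_ord0 = 1.
Proof. by rewrite /dehomogenize mmapX mmap1U unlift_none. Qed.

Lemma dehomogenize_lift i : dehomogenize 'X_(lift ord0 i) = 'X_i.
Proof. by rewrite /dehomogenize mmapX mmap1U liftK. Qed.

Lemma dehomogenize_homogenize D f : dehomogenize (homogenize D f) = f.
Proof.
rewrite [RHS]mpolyE raddf_sum; apply: eq_bigr => g _ /=.
rewrite dehomogenizeZ mpolyX_homogenize_mnm rmorphM rmorphXn /= dehomogenize_X0.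
rewrite expr1n mul1r rmorph_prod mpolyXE_id; congr (_ *: _).
apply: eq_bigr => i _.
by rewrite rmorphXn /= dehomogenize_lift.
Qed.

Lemma dehomogenize_normsq : dehomogenize normsq = 1 + normsq.
Proof.
rewrite {1}/normsq big_ord_recl rmorphD rmorphXn /= dehomogenize_X0 expr1n.
rewrite raddf_sum; congr (_ + _); apply: eq_bigr => i _.
by rewrite /= rmorphXn /= dehomogenize_lift.
Qed.

Lemma sos_dehomogenize (p : {mpoly R[n.+1]}) : sos p -> sos (dehomogenize p).
Proof.
move=> [s ->]; rewrite raddf_sum; apply: sos_sum => q _ /=.
by rewrite rmorphXn; exact: sos_sqr.
Qed.

Lemma meval_homogenize D f (y : 'I_n.+1 -> R) : (homogenize D f).@[y] =
  \sum_(g <- msupp f)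
    f@_g * (y ord0 ^+ (D - mdeg g) * \prod_(i < n) y (lift ord0 i) ^+ g i).
Proof.
rewrite raddf_sum; apply: eq_bigr => g _; rewrite /= mevalZ mpolyX_homogenize_mnm.
rewrite rmorphM rmorphXn /= mevalXU rmorph_prod; congr (_ * (_ * _)).
by apply: eq_bigr => i _; rewrite rmorphXn /= mevalXU.
Qed.

(** Off the hyperplane y_0 = 0 the value is y_0^(2d) f(y / y_0); on it, it is the
    value at 0 of a univariate polynomial in y_0 that is nonnegative elsewhere. *)
Lemma homogenize_ge0 d f : (msize f <= d.*2.+1)%N -> (forall x, 0 <= f.@[x]) ->
  forall y, 0 <= (homogenize d.*2 f).@[y].
Proof.
move=> fd f0.
have pos y : y ord0 != 0 -> 0 <= (homogenize d.*2 f).@[y].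
  move=> y0; suff -> : (homogenize d.*2 f).@[y] =
      (y ord0 ^+ d) ^+ 2 * f.@[fun i => y (lift ord0 i) / y ord0].
    by rewrite mulr_ge0 ?sqr_ge0.
  rewrite meval_homogenize mevalE mulr_sumr big_seq [RHS]big_seq.
  apply: eq_bigr => g gf; rewrite [RHS]mulrCA; congr (_ * _).
  have gd : (mdeg g <= d.*2)%N by rewrite -ltnS (leq_trans (msize_mdeg_lt gf)).
  under [in RHS]eq_bigr => i _ do rewrite exprMn.
  rewrite big_split /= prodrXr -mdegE [RHS]mulrA [RHS]mulrAC; congr (_ * _).
  by rewrite -exprM muln2 -{2}(subnK gd) exprD exprVn mulfK ?expf_neq0.
move=> y; have [y0|/pos//] := eqVneq (y ord0) 0.
pose P := \sum_(g <- msupp f)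
  (f@_g * \prod_(i < n) y (lift ord0 i) ^+ g i) *: 'X^(d.*2 - mdeg g) : {poly R}.
have PE t : P.[t] =
    (homogenize d.*2 f).@[fun j => if j == ord0 then t else y j].
  rewrite meval_homogenize horner_sum; apply: eq_bigr => g _.
  by rewrite hornerZ hornerXn eqxx mulrAC mulrA.
have -> : (homogenize d.*2 f).@[y] = P.[0].
  by rewrite PE; apply: meval_eq => j; case: eqP => // ->.
by apply: poly_ge0_punctured => t t0; rewrite PE; apply: pos; rewrite eqxx.
Qed.

End Homogenization.

(** * The perturbed polynomial *)
Section Perturbation.
Context {R : realType} {n : nat}.
Implicit Types (p q : {mpoly R[n]}) (s t : nat).

Lemma poly_leD t p q : poly_le t p -> poly_le t q -> poly_le t (p + q).
Proof.
by move=> hp hq; apply: leq_trans (msizeD_le _ _) _; rewrite geq_max hp hq.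
Qed.

Lemma poly_leM s t p q : poly_le s p -> poly_le t q -> poly_le (s + t) (p * q).
Proof.
rewrite /poly_le /= => hp hq.
have [->|p0] := eqVneq p 0; first by rewrite mul0r msize0.
have [->|q0] := eqVneq q 0; first by rewrite mulr0 msize0.
rewrite msizeM // -subn1 leq_subLR add1n -addnS -addSn; exact: leq_add.
Qed.

Lemma poly_leX s t p : poly_le s p -> poly_le (s * t) (p ^+ t).
Proof.
move=> hp; elim: t => [|t IH]; first by rewrite muln0 /poly_le /= expr0 msize1.
by rewrite exprS mulnS; apply: poly_leM.
Qed.

Lemma poly_le_theta : poly_le 2 (theta : {mpoly R[n]}).
Proof.
apply: poly_leD; first by rewrite /poly_le /= msize1.
rewrite /poly_le /=; elim/big_rec: _ => [|i p _ hp]; first by rewrite msize0.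
by apply: poly_leD => //; apply: (@poly_leX 1 2); rewrite /poly_le /= msizeX mdeg1.
Qed.

Lemma sos_theta : sos (theta : {mpoly R[n]}).
Proof.
apply: sosD; first by rewrite -(expr1n _ 2); exact: sos_sqr.
by apply: sos_sum => i _; exact: sos_sqr.
Qed.

Lemma meval_theta_gt0 (x : 'I_n -> R) : 0 < (theta : {mpoly R[n]}).@[x].
Proof.
rewrite /theta rmorphD /= meval1 raddf_sum ltr_wpDr //; apply: sumr_ge0 => i _ /=.
by rewrite rmorphXn sqr_ge0.
Qed.

Lemma poly_leBC t p c : poly_le t p -> poly_le t (p - c%:MP).
Proof.
by move=> hp; apply: poly_leD hp _; rewrite /poly_le /= msizeN msizeC; case: eqP.
Qed.

Lemma poly_le_perturbed f d k c eps : poly_le (2 * d) f ->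
  poly_le (2 * (k + d))
    (theta ^+ k * (f - c%:MP + eps *: theta ^+ d) : {mpoly R[n]}).
Proof.
move=> hf; rewrite mulnDr; apply: poly_leM; first exact/poly_leX/poly_le_theta.
apply: poly_leD; first exact: poly_leBC.
apply: leq_trans (msizeZ_le _ _) _; exact/poly_leX/poly_le_theta.
Qed.

Lemma sos_perturbed f d : poly_le (2 * d) f -> (forall x : 'I_n -> R, 0 <= f.@[x]) ->
  exists2 C : R, 0 <= C & forall k eps, C < eps * k.+1%:R ->
    sos (theta ^+ k * (f + eps *: theta ^+ d)).
Proof.
rewrite /poly_le /= mul2n => hf f0.
have [C C0 hC] := reznick (homog_homogenize hf) (homogenize_ge0 hf f0).
exists C => // k eps /hC /sos_dehomogenize.
rewrite rmorphM rmorphD /= dehomogenizeZ !rmorphXn /=.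
by rewrite dehomogenize_homogenize dehomogenize_normsq.
Qed.

End Perturbation.

Import numFieldNormedType.Exports.

Theorem theorem4p1 (R : realType) (n d : nat) (f : {mpoly R[n]})
    (hf : poly_le (2 * d) f) (hinf : (-oo < fstar f)%E) :
  (forall eps : R, 0 < eps ->
     forall k l : nat, (k <= l)%N -> (rho f d eps k <= rho f d eps l)%E)
  /\
  ((exists x : 'I_n -> R, (f.@[x])%:E = fstar f) ->
   exists K : R -> nat,
     (forall eps : R, 0 < eps ->
        forall xstar : 'I_n -> R, (f.@[xstar])%:E = fstar f ->
        forall k : nat, (K eps <= k)%N ->
          (fstar f <= rho f d eps k)%E /\
          (rho f d eps k <= fstar f + (eps * theta.@[xstar] ^+ d)%:E)%E)
     /\ exists2 C : R, 0 < C &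
          \forall eps \near 0^'+, (K eps)%:R <= C * eps^-1).
Proof.
split=> [eps eps0 k l kl|[x0 fx0]].
  apply: ereal_sup_le => _ [c [[s sE] _] <-]; exists c => //.
  split; last exact: poly_le_perturbed.
  rewrite -(subnK kl) exprD -mulrA; apply: sosM; first exact/sosX/sos_theta.
  by exists s.
have f0 y : 0 <= (f - (f.@[x0])%:MP).@[y].
  rewrite rmorphB /= mevalC subr_ge0 -lee_fin fx0.
  by apply: ereal_inf_lbound; exists y.
have [C C0 hC] := sos_perturbed (poly_leBC f.@[x0] hf) f0.
(* For k >= trunc (C / eps) one has k + 1 > C / eps, as [sos_perturbed] needs. *)
exists (fun eps => Num.truncn (C / eps)); split.
  move=> eps eps0 x fx k Kk; rewrite -fx; split.
    apply: ereal_sup_ubound; exists f.@[x] => //.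
    split; last exact: poly_le_perturbed.
    have -> : f.@[x] = f.@[x0] by apply: EFin_inj; rewrite fx fx0.
    apply: hC; rewrite mulrC -ltr_pdivrMr //.
    apply: lt_le_trans (truncnS_gt _) _; rewrite ler_nat; exact: Kk.
  apply: ge_ereal_sup => _ [c [hs _] <-]; rewrite -EFinD lee_fin.
  have := sos_meval x hs; rewrite rmorphM rmorphXn /=.
  rewrite pmulr_rge0 ?exprn_gt0 ?meval_theta_gt0 // rmorphD rmorphB /=.
  rewrite mevalC mevalZ rmorphXn /=; lra.
(* C may be 0, and a positive constant is wanted. *)
exists (C + 1); first by rewrite ltr_wpDl.
near=> eps; have eps0 : 0 < eps by near: eps; exact: nbhs_right_gt.
apply: (@le_trans _ _ (C / eps)); first by rewrite truncn_le divr_ge0 // ltW.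
by rewrite ler_wpM2r ?invr_ge0 ?(ltW eps0) // lerDl.
Unshelve. all: by end_near.
Qed.
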